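(* Let $f(u,u_x)$ and $g(u,u_x)$ be given functions, $C^0$ in $u$ and $C^1$ in $u_x$, and consider the nonlinear dispersive wave equation $$m_t+f(u,u_x)m+(g(u,u_x)m)_x=0,\qquad m=u-u_{xx}.$$ Let $f^+(u,u_x)=\tfrac12(f(u,u_x)+f(u,-u_x))$ and $g^+(u,u_x)=\tfrac12(g(u,u_x)+g(u,-u_x))$. (i) The amplitude $A(t)$ and position $X(t)$ of dynamical peaked waves $u(x,t)=A(t)e^{-|x-X(t)|}$ satisfy the coupled nonlinear ODEs $$\dot A=-\int_{-A}^{A}f^+(A,y)\,dy,\qquad \dot X=(1/A)\int_{-A}^{A}g^+(A,y)\,dy$$ in terms of the nonlinearities $f(u,u_x)$ and $g(u,u_x)$ in the given wave equation. (ii) A dynamical peaked wave will be a travelling-wave peakon, with a non-zero speed, if and only if $A=a$ is an arbitrary constant and $\dot X=c$ is a non-zero constant. These two conditions hold when (and only when) $f(u,u_x)$ and $g(u,u_x)$ satisfy $$\int_{-a}^{a}f^+(a,y)\,dy=0,\qquad \int_{-a}^{a}g^+(a,y)\,dy\neq0,\qquad\text{for all } a\in\mathbb{R}.$$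
   Context: Dynamical peaked waves (dynamical peakons) are the single-peakon weak solutions $u(x,t)=A(t)e^{-|x-X(t)|}$, with amplitude $A(t)$ and position $X(t)$, of the given wave equation. Their dynamics is the one-peakon case of the multi-peakon dynamical system of the equation, namely $\dot A=\tfrac12[F(u,u_x)]_{X}$, $\dot X=-\tfrac12[G(u,u_x)]_{X}/A$, where $F=\int f\,du_x$ and $G=\int g\,du_x$ are antiderivatives with respect to $u_x$, and $[\cdot]_X$ denotes the jump at the discontinuity $x=X(t)$. A travelling-wave peakon is a peaked wave with constant amplitude and constant speed, $u(x,t)=a\,e^{-|x-ct-x_0|}$ with constants $a$, $c$, $x_0$; its speed is $c$.
   Formalization: Both ODEs in (i) carry an extra factor 1/2, as the stated jump system forces (f=u_x, g=u gives X'=A, not 2A); in (ii) the g^+ integral is required non-zero only for a≠0, since it vanishes at a=0; f, g and their antiderivatives F, G are taken jointly continuous, and A≠0. *)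

(* Defs.v *)
From Stdlib Require Import Reals.
From Coquelicot Require Import Coquelicot.

Open Scope R_scope.

(* h(u, u_x) is continuous, and C^1 in u_x.  Continuity is joint: under
   separate continuity in u and u_x, the jump of an antiderivative along a
   peaked profile need not exist. *)
Definition C0_C1 (h : R -> R -> R) : Prop :=
  (forall u y, continuous (fun p : R * R => h (fst p) (snd p)) (u, y)) /\
  (forall u y, ex_derive (h u) y /\ continuous (Derive (h u)) y).

(* H = int h du_x, up to a function of u; requiring H to be continuous
   excludes adding a discontinuous function of u. *)
Definition antiderivative_ux (H h : R -> R -> R) : Prop :=
  (forall u y, continuous (fun p : R * R => H (fst p) (snd p)) (u, y)) /\
  (forall u y, is_derive (H u) y (h u y)).

Definition even_part (h : R -> R -> R) (u y : R) : R :=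
  / 2 * (h u y + h u (- y)).

Definition peaked_wave (A X : R -> R) (x t : R) : R :=
  A t * exp (- Rabs (x - X t)).

Definition in_interval (T0 T1 : Rbar) (t : R) : Prop :=
  Rbar_lt T0 t /\ Rbar_lt t T1.

(* J = [h]_{x0}; at_left and at_right exclude the point x0 itself. *)
Definition is_jump (h : R -> R) (x0 J : R) : Prop :=
  exists l r : R,
    filterlim h (at_left x0) (locally l) /\
    filterlim h (at_right x0) (locally r) /\
    J = r - l.

Definition is_jump_along (H : R -> R -> R) (u : R -> R) (x0 J : R) : Prop :=
  is_jump (fun x => H (u x) (Derive u x)) x0 J.

(* The one-peakon dynamical system of m_t + f m + (g m)_x = 0, m = u - u_xx,
   where F, G are antiderivatives of f, g with respect to u_x:
     A' = 1/2 [F(u,u_x)]_X,   X' = -1/2 [G(u,u_x)]_X / A.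
   For u = A exp(-|x - X|) one has m = 2 A delta_X, f m = -[F]_X delta_X and
   g m = -[G]_X delta_X in the weak sense; the system collects the coefficients
   of delta_X and delta_X'.  Since solutions may vanish or blow up in finite
   time, they live on an open time interval ]T0, T1[, on which the
   amplitude is nonzero (the equation for X divides by it). *)
Definition dynamical_peaked_wave (F G : R -> R -> R) (T0 T1 : Rbar)
    (A X : R -> R) : Prop :=
  Rbar_lt T0 T1 /\
  forall t, in_interval T0 T1 t ->
    A t <> 0 /\
    exists JF JG : R,
      is_jump_along F (fun x => peaked_wave A X x t) (X t) JF /\
      is_jump_along G (fun x => peaked_wave A X x t) (X t) JG /\
      is_derive A t (/ 2 * JF) /\
      is_derive X t (- (/ 2) * JG / A t).

Definition travelling_wave_peakon (T0 T1 : Rbar) (u : R -> R -> R) (c : R) : Prop :=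
  exists a x0 : R,
    forall t, in_interval T0 T1 t ->
      forall x, u x t = a * exp (- Rabs (x - c * t - x0)).

Definition constant_amplitude (T0 T1 : Rbar) (A : R -> R) (a : R) : Prop :=
  forall t, in_interval T0 T1 t -> A t = a.

Definition constant_speed (T0 T1 : Rbar) (X : R -> R) (c : R) : Prop :=
  forall t, in_interval T0 T1 t -> is_derive X t c.

(* Main.v *)
(* The jump of [H(u, u_x)] at the crest of [a exp(-|x - x0|)] is
   [H(a,-a) - H(a,a)], which turns the one-peakon system into an autonomous
   system A' = phi(A), X' = psi(A), where phi(a) and psi(a) are multiples of the
   integrals of f^+ and g^+ over [-a, a].  Constant amplitudes are zeros of phi.
   That every a <> 0 must be a zero of phi, when all waves have constant
   amplitude, needs a wave with nonconstant amplitude near a point where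
   phi(a) <> 0.  As phi and psi are only continuous, it is found by separation
   of variables: A inverts a primitive of 1/phi, and X = Y o A with Y a primitive
   of psi/phi. *)
Require Import Defs.
From Stdlib Require Import Reals Ranalysis5 Lra ClassicalEpsilon.
From Coquelicot Require Import Coquelicot.
Open Scope R_scope.

(** * Peaked profiles and jumps at the crest *)

Lemma continuous_Ropp (x : R) : continuous Ropp x.
Proof.
exact (continuous_opp (V := R_NormedModule) (fun x => x) x (continuous_id x)).
Qed.

(** A peaked wave frozen in time: [fun x => peaked_wave A X x t] is convertible to
    [profile (A t) (X t)], so facts about profiles apply to waves as they stand. *)
Definition profile (a x0 x : R) : R := a * exp (- Rabs (x - x0)).

Lemma profile_continuous (a x0 x : R) : continuous (profile a x0) x.
Proof.
apply (continuous_mult (fun _ => a) (fun x => exp (- Rabs (x - x0)))).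
- apply continuous_const.
- apply (continuous_comp (fun x => - Rabs (x - x0)) exp).
  + apply (continuous_opp (fun x => Rabs (x - x0))).
    apply (continuous_comp (fun x => x - x0) Rabs).
    * apply (continuous_minus (fun x => x) (fun _ => x0));
        [apply continuous_id | apply continuous_const].
    * apply continuous_Rabs.
  + apply continuity_pt_filterlim, derivable_continuous_pt, derivable_pt_exp.
Qed.

Lemma profile_center (a x0 : R) : profile a x0 x0 = a.
Proof.
unfold profile; rewrite Rminus_diag, Rabs_R0, Ropp_0, exp_0; ring.
Qed.

Lemma Derive_profile_left (a x0 x : R) :
  x < x0 -> Derive (profile a x0) x = profile a x0 x.
Proof.
intros hx; unfold profile; rewrite (Rabs_left (x - x0)) by lra.
rewrite (Derive_ext_loc _ (fun y => a * exp (y - x0))).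
- apply is_derive_unique; auto_derive; [easy |].
  unfold Rminus; rewrite Ropp_involutive; ring.
- apply (locally_interval _ x m_infty x0); simpl; [easy | easy |].
  intros y _ hy; rewrite Rabs_left by lra; f_equal; f_equal; ring.
Qed.

Lemma Derive_profile_right (a x0 x : R) :
  x0 < x -> Derive (profile a x0) x = - profile a x0 x.
Proof.
intros hx; unfold profile; rewrite (Rabs_right (x - x0)) by lra.
rewrite (Derive_ext_loc _ (fun y => a * exp (- (y - x0)))).
- apply is_derive_unique; auto_derive; [easy |].
  unfold Rminus; ring.
- apply (locally_interval _ x x0 p_infty); simpl; [easy | easy |].
  intros y hy _; rewrite Rabs_right by lra; reflexivity.
Qed.

Lemma is_jump_unique (h : R -> R) (x0 J1 J2 : R) :
  is_jump h x0 J1 -> is_jump h x0 J2 -> J1 = J2.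
Proof.
intros [l1 [r1 [hl1 [hr1 ->]]]] [l2 [r2 [hl2 [hr2 ->]]]].
f_equal; [| f_equal].
- exact (filterlim_locally_unique (F := at_right x0) h r1 r2 hr1 hr2).
- exact (filterlim_locally_unique (F := at_left x0) h l1 l2 hl1 hl2).
Qed.

Definition jointly_continuous (H : R -> R -> R) : Prop :=
  forall u y, continuous (fun p : R * R => H (fst p) (snd p)) (u, y).

(** Left of the crest [u_x = u] and right of it [u_x = - u]. Both composites extend continuously to
    the crest, where [u = a], so the one-sided limits are [H a a] and [H a (- a)]. *)
Lemma is_jump_along_profile (H : R -> R -> R) (a x0 : R) :
  jointly_continuous H ->
  is_jump_along H (profile a x0) x0 (H a (- a) - H a a).
Proof.
intros hH; exists (H a a), (H a (- a)); split; [| split; [| reflexivity]].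
- apply filterlim_ext_loc
    with (fun x => H (profile a x0 x) (profile a x0 x)).
  + unfold at_left, within; apply filter_forall.
    intros x hx; now rewrite Derive_profile_left.
  + refine (filterlim_filter_le_1 (F := locally x0) _ _ _);
      [apply filter_le_within |].
    assert (hc : continuous (fun x => H (profile a x0 x) (profile a x0 x)) x0).
    { apply (continuous_comp_2 (profile a x0) (profile a x0) H);
        [apply profile_continuous | apply profile_continuous | apply hH]. }
    unfold continuous in hc; now rewrite profile_center in hc.
- apply filterlim_ext_loc
    with (fun x => H (profile a x0 x) (- profile a x0 x)).
  + unfold at_right, within; apply filter_forall.
    intros x hx; now rewrite Derive_profile_right.
  + refine (filterlim_filter_le_1 (F := locally x0) _ _ _);
      [apply filter_le_within |].
    assert (hc : continuous (fun x => H (profile a x0 x) (- profile a x0 x)) x0).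
    { apply (continuous_comp_2 (profile a x0) (fun x => - profile a x0 x) H);
        [| apply (continuous_opp (profile a x0)) | apply hH];
        apply profile_continuous. }
    unfold continuous in hc; now rewrite profile_center in hc.
Qed.

(** * The autonomous system for amplitude and position *)

Lemma dynamical_peaked_wave_ode (F G : R -> R -> R) (T0 T1 : Rbar) (A X : R -> R) :
  jointly_continuous F -> jointly_continuous G ->
  dynamical_peaked_wave F G T0 T1 A X <->
  Rbar_lt T0 T1 /\
  forall t, in_interval T0 T1 t ->
    A t <> 0 /\
    is_derive A t (/ 2 * (F (A t) (- A t) - F (A t) (A t))) /\
    is_derive X t (- (/ 2) * (G (A t) (- A t) - G (A t) (A t)) / A t).
Proof.
intros hF hG; split; intros [hT h]; (split; [exact hT |]); intros t ht.
- destruct (h t ht) as [hA [JF [JG [hJF [hJG [hA' hX']]]]]].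
  (* Uniqueness of jumps identifies the given [JF] and [JG] with the values computed at the
     crest. *)
  rewrite (is_jump_unique _ _ _ _ (is_jump_along_profile F (A t) (X t) hF) hJF).
  rewrite (is_jump_unique _ _ _ _ (is_jump_along_profile G (A t) (X t) hG) hJG).
  auto.
- destruct (h t ht) as [hA [hA' hX']]; split; [exact hA |].
  exists (F (A t) (- A t) - F (A t) (A t)), (G (A t) (- A t) - G (A t) (A t)).
  split; [exact (is_jump_along_profile F (A t) (X t) hF) |].
  split; [exact (is_jump_along_profile G (A t) (X t) hG) |].
  auto.
Qed.

(** The odd part of [H u] is a primitive of the even part of [h u]. Being odd, it takes opposite
    values at [u] and [- u], so its increment is the full difference and the factor 1/2
    disappears. *)
Lemma RInt_even_part (h H : R -> R -> R) (u : R) :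
  C0_C1 h -> antiderivative_ux H h ->
  RInt (even_part h u) (- u) u = H u u - H u (- u).
Proof.
intros [_ hh] [_ hH]; apply is_RInt_unique.
assert (hc : forall y, continuous (h u) y).
{ intros y; apply (ex_derive_continuous (h u)), hh. }
replace (H u u - H u (- u)) with
  (minus (/ 2 * (H u u - H u (- u))) (/ 2 * (H u (- u) - H u (- - u))))
  by (rewrite Ropp_involutive; unfold minus, plus, opp; simpl; field).
apply (is_RInt_derive (fun y => / 2 * (H u y - H u (- y)))).
- intros y _; unfold even_part.
  replace (/ 2 * (h u y + h u (- y)))
    with (/ 2 * (h u y - -1 * h u (- y))) by ring.
  apply (is_derive_scal (fun y => H u y - H u (- y))).
  apply (is_derive_minus (H u) (fun y => H u (- y))); [apply hH |].
  apply (is_derive_comp (H u) Ropp); [apply hH |].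
  auto_derive; [easy | ring].
- intros y _; apply (continuous_mult (fun _ => / 2) (fun y => h u y + h u (- y))).
  + apply continuous_const.
  + apply (continuous_plus (h u) (fun y => h u (- y))); [apply hc |].
    apply (continuous_comp Ropp (h u)); [apply continuous_Ropp | apply hc].
Qed.

(** * Local solutions by separation of variables *)

Lemma ex_primitive (h : R -> R) (p q : R) :
  (forall s, p < s < q -> continuous h s) ->
  exists Y : R -> R, forall s, p < s < q -> is_derive Y s (h s).
Proof.
intros hh; exists (RInt h ((p + q) / 2)); intros s hs.
apply is_derive_RInt with ((p + q) / 2); [| now apply hh].
apply (locally_interval _ s p q); simpl; try apply hs.
intros y hy1 hy2; apply (RInt_correct h), ex_RInt_continuous.
intros z hz; apply hh.
assert (p < (p + q) / 2 < q) by lra.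
revert hz; unfold Rmin, Rmax; destruct (Rle_dec _ _); lra.
Qed.

Lemma ex_increasing_inverse (T dT : R -> R) (p q : R) :
  p < q ->
  (forall s, p <= s <= q -> is_derive T s (dT s) /\ 0 < dT s) ->
  T p < T q /\
  exists A : R -> R, forall t, T p < t < T q ->
    p < A t < q /\ is_derive A t (/ dT (A t)).
Proof.
intros hpq hT.
assert (incr : forall x y, p <= x -> x < y -> y <= q -> T x < T y).
{ intros x y h1 h2 h3; apply (incr_function_le T p q dT); simpl; try easy;
  intros z hz1 hz2; now apply hT. }
assert (hder : forall s, p <= s <= q -> derivable_pt T s).
{ intros s hs; exists (dT s); now apply is_derive_Reals, hT. }
(* The existential precedes the implication so that choice yields a total [A]; outside the range of
   [T] its value is arbitrary. *)
assert (hinv : forall t, exists s, T p <= t <= T q -> p <= s <= q /\ T s = t).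
{ intros t; destruct (excluded_middle_informative (T p <= t <= T q)) as [ht | ht].
  - destruct (f_interv_is_interv T p q t hpq ht) as [s hs].
    + intros x hx; now apply derivable_continuous_pt, hder.
    + now exists s.
  - now exists 0. }
split; [apply incr; lra |].
set (A t := proj1_sig (constructive_indefinite_description _ (hinv t))).
assert (hA : forall t, T p <= t <= T q -> p <= A t <= q /\ T (A t) = t).
{ intros t; exact (proj2_sig (constructive_indefinite_description _ (hinv t))). }
exists A; intros t ht.
destruct (hA t ltac:(lra)) as [hAt hTA].
assert (hAt' : p < A t < q).
{ split; apply Rnot_le_lt; intros h; revert ht.
  - replace p with (A t) by lra; intros; lra.
  - replace q with (A t) by lra; intros; lra. }
split; [exact hAt' |].
destruct (hT (A t) hAt) as [hdT hpos].
assert (hdA : derivable_pt A t).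
{ refine (derivable_pt_recip_interv T A p q t hpq ht
    (fun x h1 h2 => proj2 (hA x (conj h1 h2)))
    (fun x h1 h2 => proj1 (hA x (conj h1 h2))) incr hder _).
  intros h0; apply (Rgt_not_eq _ _ hpos).
  rewrite <- h0; symmetry; apply derive_pt_eq; now apply is_derive_Reals. }
(* Differentiability of the inverse is known; its derivative comes from differentiating
   [T (A t) = t]. *)
destruct hdA as [l hl]; apply is_derive_Reals in hl.
assert (h1 : scal l (dT (A t)) = 1).
{ transitivity (Derive (fun t => T (A t)) t).
  - symmetry; apply is_derive_unique; now apply (is_derive_comp T A).
  - rewrite (Derive_ext_loc _ (fun t => t)); [apply Derive_id |].
    apply (locally_interval _ t (T p) (T q)); simpl; try apply ht.
    intros y hy1 hy2; apply hA; lra. }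
unfold scal in h1; simpl in h1; unfold mult in h1; simpl in h1.
replace (/ dT (A t)) with l; [exact hl |].
apply Rmult_eq_reg_r with (dT (A t)); [rewrite h1; field |]; lra.
Qed.

(** With the amplitude as independent variable, time is [T] with [T' = 1 / phi] and position is [Y]
    with [Y' = psi / phi]. Inverting [T] gives [A' = phi (A)], and the chain rule gives
    [(Y o A)' = psi (A)]. *)
Lemma ex_local_solution_pos (phi psi : R -> R) (p q : R) :
  p < q ->
  (forall s, p < s < q -> continuous phi s /\ continuous psi s /\ 0 < phi s) ->
  exists (t0 t1 : R) (A X : R -> R),
    t0 < t1 /\
    forall t, t0 < t < t1 ->
      p < A t < q /\ is_derive A t (phi (A t)) /\ is_derive X t (psi (A t)).
Proof.
intros hpq h.
destruct (ex_primitive (fun s => / phi s) p q) as [T hT].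
{ intros s hs; destruct (h s hs) as [hphi [_ hpos]].
  apply continuous_Rinv_comp; [exact hphi | lra]. }
destruct (ex_primitive (fun s => psi s * / phi s) p q) as [Y hY].
{ intros s hs; destruct (h s hs) as [hphi [hpsi hpos]].
  apply (continuous_mult psi (fun s => / phi s)); [exact hpsi |].
  apply continuous_Rinv_comp; [exact hphi | lra]. }
(* The middle third of []p, q[] is a closed interval on which [T] is differentiable up to the
   endpoints. *)
destruct (ex_increasing_inverse T (fun s => / phi s)
            ((2 * p + q) / 3) ((p + 2 * q) / 3)) as [hlt [A hA]]; [lra | |].
{ intros s hs; split; [apply hT; lra |].
  apply Rinv_0_lt_compat, h; lra. }
exists (T ((2 * p + q) / 3)), (T ((p + 2 * q) / 3)), A, (fun t => Y (A t)).
split; [exact hlt |]; intros t ht.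
destruct (hA t ht) as [hAt hA']; rewrite Rinv_inv in hA'.
assert (hAt' : p < A t < q) by lra.
split; [exact hAt' |]; split; [exact hA' |].
destruct (h (A t) hAt') as [_ [_ hpos]].
replace (psi (A t)) with (scal (phi (A t)) (psi (A t) * / phi (A t)))
  by (unfold scal; simpl; unfold mult; simpl; field; lra).
apply (is_derive_comp Y A); [now apply hY | exact hA'].
Qed.

(** Time reversal, which reduces a negative [phi] to a positive one. *)
Lemma is_derive_reflect (A : R -> R) (t l : R) :
  is_derive A (- t) (- l) -> is_derive (fun t => A (- t)) t l.
Proof.
intros h; replace l with (scal (-1) (- l))
  by (unfold scal; simpl; unfold mult; simpl; ring).
apply (is_derive_comp A Ropp); [exact h |].
auto_derive; [easy | ring].
Qed.

(** The clause [phi (A t) <> 0] is carried along because it will contradict constancy of the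
    amplitude. *)
Lemma ex_local_solution (phi psi : R -> R) (a : R) :
  a <> 0 -> phi a <> 0 ->
  (forall s, continuous phi s) -> (forall s, s <> 0 -> continuous psi s) ->
  exists (t0 t1 : R) (A X : R -> R),
    t0 < t1 /\
    forall t, t0 < t < t1 ->
      A t <> 0 /\ phi (A t) <> 0 /\
      is_derive A t (phi (A t)) /\ is_derive X t (psi (A t)).
Proof.
intros ha hphia hphi hpsi.
(* The product condition says that [phi] keeps the sign of [phi a] near [a], covering both signs at
   once. *)
assert (hloc : locally a (fun s => s <> 0 /\ 0 < phi s * phi a)).
{ apply filter_and.
  - now apply (open_neq 0).
  - assert (hc : continuous (fun s => phi s * phi a) a)
      by (apply (continuous_mult phi (fun _ => phi a));
          [apply hphi | apply continuous_const]).
    apply hc, (open_gt 0); now apply Rlt_0_sqr. }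
destruct hloc as [[r hr] hloc].
assert (hnear : forall s, a - r < s < a + r -> s <> 0 /\ 0 < phi s * phi a).
{ intros s hs; apply hloc; unfold ball; simpl; unfold AbsRing_ball, abs, minus,
  plus, opp; simpl; apply Rabs_def1; lra. }
destruct (Rdichotomy _ _ hphia) as [hneg | hpos].
(* For [phi a < 0] the system with both right-hand sides negated is solved and then run backwards in
   time. *)
- destruct (ex_local_solution_pos (fun s => - phi s) (fun s => - psi s)
             (a - r) (a + r)) as [t0 [t1 [A [X [hlt h]]]]]; [lra | |].
  + intros s hs; destruct (hnear s hs) as [hs0 hsp]; split; [| split].
    * apply (continuous_opp phi), hphi.
    * now apply (continuous_opp psi), hpsi.
    * nra.
  + exists (- t1), (- t0), (fun t => A (- t)), (fun t => X (- t)).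
    split; [lra |]; intros t ht.
    destruct (h (- t)) as [hA [hA' hX']]; [lra |].
    destruct (hnear _ hA) as [hA0 hAp].
    split; [exact hA0 |]; split; [intros h0; rewrite h0 in hAp; lra |].
    now split; apply is_derive_reflect.
- destruct (ex_local_solution_pos phi psi (a - r) (a + r))
    as [t0 [t1 [A [X [hlt h]]]]]; [lra | |].
  + intros s hs; destruct (hnear s hs) as [hs0 hsp]; split; [| split].
    * apply hphi.
    * now apply hpsi.
    * nra.
  + exists t0, t1, A, X.
    split; [exact hlt |]; intros t ht.
    destruct (h t ht) as [hA [hA' hX']].
    destruct (hnear _ hA) as [hA0 hAp].
    split; [exact hA0 |]; split; [intros h0; rewrite h0 in hAp; lra |].
    now split.
Qed.

(** * Time intervals, uniform motion and travelling waves *)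

Lemma in_interval_locally (T0 T1 : Rbar) (t : R) (P : R -> Prop) :
  in_interval T0 T1 t -> (forall s, in_interval T0 T1 s -> P s) -> locally t P.
Proof.
intros [h0 h1] h; apply (locally_interval P t T0 T1 h0 h1).
intros s hs0 hs1; now apply h.
Qed.

Lemma in_interval_nonempty (T0 T1 : Rbar) :
  Rbar_lt T0 T1 -> exists t, in_interval T0 T1 t.
Proof.
unfold in_interval; destruct T0 as [x | |], T1 as [y | |]; simpl; try easy; intros h.
- exists ((x + y) / 2); lra.
- exists (x + 1); lra.
- exists (y - 1); lra.
- now exists 0.
Qed.

Lemma in_interval_convex (T0 T1 : Rbar) (s t x : R) :
  in_interval T0 T1 s -> in_interval T0 T1 t -> s <= x <= t -> in_interval T0 T1 x.
Proof.
intros [hs _] [_ ht] hx; split.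
- apply Rbar_lt_le_trans with s; [exact hs | apply hx].
- apply Rbar_le_lt_trans with t; [apply hx | exact ht].
Qed.

(** [X t - c * t] has zero derivative on a convex set of times, so it keeps its value at a chosen
    time [t0]. *)
Lemma constant_speed_affine (T0 T1 : Rbar) (X : R -> R) (c : R) :
  Rbar_lt T0 T1 -> constant_speed T0 T1 X c ->
  exists x0, forall t, in_interval T0 T1 t -> X t = c * t + x0.
Proof.
intros hT hX; destruct (in_interval_nonempty T0 T1 hT) as [t0 ht0].
assert (h0 : forall t, in_interval T0 T1 t -> is_derive (fun t => X t - c * t) t 0).
{ intros t ht; replace 0 with (c - c) by ring.
  apply (is_derive_minus X (fun t => c * t)); [now apply hX |].
  auto_derive; [easy | ring]. }
assert (heq : forall s t, in_interval T0 T1 s -> in_interval T0 T1 t -> s < t ->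
  X s - c * s = X t - c * t).
{ intros s t hs ht hlt; apply (eq_is_derive (fun t => X t - c * t)); [| exact hlt].
  intros x hx; apply h0; now apply in_interval_convex with s t. }
exists (X t0 - c * t0); intros t ht.
destruct (Rtotal_order t t0) as [hlt | [-> | hlt]].
- pose proof (heq t t0 ht ht0 hlt); lra.
- lra.
- pose proof (heq t0 t ht0 ht hlt); lra.
Qed.

Lemma constant_amplitude_derive (T0 T1 : Rbar) (A : R -> R) (a t : R) :
  constant_amplitude T0 T1 A a -> in_interval T0 T1 t -> is_derive A t 0.
Proof.
intros hA ht; apply is_derive_ext_loc with (fun _ => a).
- apply (in_interval_locally T0 T1); [exact ht |].
  intros s hs; symmetry; now apply hA.
- apply (is_derive_const a).
Qed.

(** Evaluating at the two crests gives [a = b * e] and [a * e = b] with the same [e > 0], by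
    symmetry of the distance. Hence [e * e = 1] and [e = 1], which forces the crests to coincide. *)
Lemma profile_inj (a b x0 y0 : R) :
  a <> 0 -> (forall x, profile a x0 x = profile b y0 x) -> a = b /\ x0 = y0.
Proof.
intros ha h.
set (e := exp (- Rabs (x0 - y0))).
assert (h1 : a = b * e) by (rewrite <- (profile_center a x0); apply h).
assert (h2 : a * e = b).
{ rewrite <- (profile_center b y0), <- h; unfold profile, e.
  now rewrite Rabs_minus_sym. }
assert (he : 0 < e) by apply exp_pos.
assert (he1 : e = 1).
{ assert (h3 : a * (e * e - 1) = 0) by (rewrite <- h2 in h1; lra).
  destruct (Rmult_integral _ _ h3) as [| h4]; [easy | nra]. }
split; [rewrite he1 in h1; lra |].
assert (h3 : - Rabs (x0 - y0) = 0) by (apply exp_inv; rewrite exp_0; exact he1).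
destruct (Req_dec (x0 - y0) 0) as [| hne]; [lra |].
apply Rabs_no_R0 in hne; lra.
Qed.

(** A nonzero profile determines its amplitude and crest, so at each time both can be read off from
    the wave. Conversely, constant speed integrates to an affine position. *)
Lemma travelling_wave_peakon_iff (T0 T1 : Rbar) (A X : R -> R) (c : R) :
  Rbar_lt T0 T1 -> (forall t, in_interval T0 T1 t -> A t <> 0) ->
  travelling_wave_peakon T0 T1 (peaked_wave A X) c <->
  (exists a, constant_amplitude T0 T1 A a) /\ constant_speed T0 T1 X c.
Proof.
intros hT hA; split.
- intros [a [x0 h]].
  assert (heq : forall t, in_interval T0 T1 t -> A t = a /\ X t = c * t + x0).
  { intros t ht; apply profile_inj; [now apply hA |].
    intros x; unfold profile.
    replace (x - (c * t + x0)) with (x - c * t - x0) by ring; now apply h. }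
  split; [exists a; intros t ht; now apply heq |].
  intros t ht; apply is_derive_ext_loc with (fun t => c * t + x0).
  + apply (in_interval_locally T0 T1); [exact ht |].
    intros s hs; symmetry; now apply heq.
  + auto_derive; [easy | ring].
- intros [[a ha] hX].
  destruct (constant_speed_affine T0 T1 X c hT hX) as [x0 hx0].
  exists a, x0; intros t ht x; unfold peaked_wave.
  rewrite (ha t ht), (hx0 t ht); do 4 f_equal; ring.
Qed.

(** * Equilibria of the amplitude equation *)

Lemma antidiagonal_continuous (H : R -> R -> R) (u : R) :
  jointly_continuous H -> continuous (fun u => H u (- u) - H u u) u.
Proof.
intros hH; apply (continuous_minus (fun u => H u (- u)) (fun u => H u u)).
- apply (continuous_comp_2 (fun u => u) Ropp H); 
    [apply continuous_id | apply continuous_Ropp | apply hH].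
- apply (continuous_comp_2 (fun u => u) (fun u => u) H);
    [apply continuous_id | apply continuous_id | apply hH].
Qed.

(** [F a a = F a (- a)] makes [a] an equilibrium, and the position equation then has a constant
    right-hand side. *)
Lemma constant_wave (F G : R -> R -> R) (T0 T1 : Rbar) (a : R) :
  jointly_continuous F -> jointly_continuous G -> Rbar_lt T0 T1 ->
  a <> 0 -> F a a = F a (- a) ->
  dynamical_peaked_wave F G T0 T1 (fun _ => a)
    (fun t => - (/ 2) * (G a (- a) - G a a) / a * t).
Proof.
intros hF hG hT ha hFa; apply dynamical_peaked_wave_ode; [easy | easy |].
split; [exact hT |]; intros t _; split; [exact ha | split].
- rewrite hFa, Rminus_diag, Rmult_0_r; apply (is_derive_const a).
- auto_derive; [easy | ring].
Qed.

(** If [a] were not an equilibrium, a local solution near [a] would be a dynamical peaked wave whose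
    amplitude has nonzero derivative. *)
Lemma equal_values_of_constant_amplitude (F G : R -> R -> R) (a : R) :
  jointly_continuous F -> jointly_continuous G -> a <> 0 ->
  (forall (T0 T1 : Rbar) (A X : R -> R),
     dynamical_peaked_wave F G T0 T1 A X ->
     exists b, constant_amplitude T0 T1 A b) ->
  F a a = F a (- a).
Proof.
intros hF hG ha hconst.
destruct (Req_dec (/ 2 * (F a (- a) - F a a)) 0) as [h0 | hne]; [lra | exfalso].
destruct (ex_local_solution (fun u => / 2 * (F u (- u) - F u u))
  (fun u => - (/ 2) * (G u (- u) - G u u) / u) a ha hne)
  as [t0 [t1 [A [X [hlt h]]]]].
- intros u; apply (continuous_mult (fun _ => / 2) (fun u => F u (- u) - F u u));
    [apply continuous_const | now apply antidiagonal_continuous].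
- intros u hu.
  apply (continuous_mult (fun u => - (/ 2) * (G u (- u) - G u u)) Rinv);
    [| now apply continuous_Rinv].
  apply (continuous_mult (fun _ => - (/ 2)) (fun u => G u (- u) - G u u));
    [apply continuous_const | now apply antidiagonal_continuous].
- destruct (hconst t0 t1 A X) as [b hb].
  + apply dynamical_peaked_wave_ode; [easy | easy |].
    split; [exact hlt |]; intros t ht.
    destruct (h t ht) as [hA [_ [hA' hX']]]; auto.
  + destruct (in_interval_nonempty t0 t1 hlt) as [t ht].
    destruct (h t ht) as [_ [hphi [hA' _]]]; apply hphi.
    rewrite <- (is_derive_unique _ _ _ hA').
    apply is_derive_unique; now apply (constant_amplitude_derive t0 t1 A b).
Qed.

(** The amplitude is treated as a position moving with speed 0. *)
Lemma constant_of_zero_derive (T0 T1 : Rbar) (A : R -> R) :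
  Rbar_lt T0 T1 -> constant_speed T0 T1 A 0 ->
  exists a, constant_amplitude T0 T1 A a.
Proof.
intros hT hA; destruct (constant_speed_affine T0 T1 A 0 hT hA) as [a ha].
exists a; intros t ht; rewrite (ha t ht); ring.
Qed.

(** The jump of [F] at the crest is minus the integral of f^+, and likewise for [G], so the factor
    1/2 of the one-peakon system survives in (i). At [a = 0] the integral of g^+ is over a point and
    vanishes, so it can be required to be nonzero only for [a <> 0]. *)
Theorem proposition1 (f g F G : R -> R -> R)
    (hf : C0_C1 f) (hg : C0_C1 g)
    (hF : antiderivative_ux F f) (hG : antiderivative_ux G g) :
  (* (i) *)
  (forall (T0 T1 : Rbar) (A X : R -> R),
     dynamical_peaked_wave F G T0 T1 A X ->
     forall t, in_interval T0 T1 t ->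
       is_derive A t (- (/ 2) * RInt (even_part f (A t)) (- A t) (A t)) /\
       is_derive X t (/ 2 * (1 / A t) * RInt (even_part g (A t)) (- A t) (A t)))
  /\
  (* (ii), criterion for a single wave *)
  (forall (T0 T1 : Rbar) (A X : R -> R),
     dynamical_peaked_wave F G T0 T1 A X ->
     forall c : R, c <> 0 ->
       (travelling_wave_peakon T0 T1 (peaked_wave A X) c <->
        (exists a : R, constant_amplitude T0 T1 A a) /\
        constant_speed T0 T1 X c))
  /\
  (* (ii), the two conditions hold for every dynamical peaked wave *)
  ((forall (T0 T1 : Rbar) (A X : R -> R),
      dynamical_peaked_wave F G T0 T1 A X ->
      (exists a : R, constant_amplitude T0 T1 A a) /\
      (exists c : R, c <> 0 /\ constant_speed T0 T1 X c)) <->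
   (forall a : R,
      RInt (even_part f a) (- a) a = 0 /\
      (a <> 0 -> RInt (even_part g a) (- a) a <> 0)))
  /\
  (* (ii), the constant a is arbitrary *)
  ((forall a : R, a <> 0 ->
      exists (A X : R -> R),
        dynamical_peaked_wave F G m_infty p_infty A X /\
        constant_amplitude m_infty p_infty A a /\
        (exists c : R, c <> 0 /\ constant_speed m_infty p_infty X c)) <->
   (forall a : R,
      RInt (even_part f a) (- a) a = 0 /\
      (a <> 0 -> RInt (even_part g a) (- a) a <> 0))).
Proof.
pose proof (proj1 hF : jointly_continuous F) as cF.
pose proof (proj1 hG : jointly_continuous G) as cG.
assert (IF : forall u, RInt (even_part f u) (- u) u = F u u - F u (- u))
  by (intros u; now apply RInt_even_part).
assert (IG : forall u, RInt (even_part g u) (- u) u = G u u - G u (- u))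
  by (intros u; now apply RInt_even_part).
(* No dynamical peaked wave has amplitude 0, so this value cannot be obtained from waves. *)
assert (zero_case : RInt (even_part f 0) (- 0) 0 = 0)
  by (rewrite IF, Ropp_0; apply Rminus_diag).
split; [| split; [| split; [split | split]]].
- intros T0 T1 A X hw t ht.
  apply dynamical_peaked_wave_ode in hw; [| easy | easy].
  destruct (proj2 hw t ht) as [hA [hA' hX']]; rewrite IF, IG; split.
  + replace (- (/ 2) * _) with (/ 2 * (F (A t) (- A t) - F (A t) (A t))) by ring.
    exact hA'.
  + replace (/ 2 * _ * _)
      with (- (/ 2) * (G (A t) (- A t) - G (A t) (A t)) / A t) by (field; exact hA).
    exact hX'.
- intros T0 T1 A X [hT hw] c _; apply travelling_wave_peakon_iff; [exact hT |].
  intros t ht; now apply hw.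
- intros hall a; destruct (Req_dec a 0) as [-> | ha]; [now split |].
  assert (hFa : F a a = F a (- a)).
  { apply (equal_values_of_constant_amplitude F G a cF cG ha).
    intros T0 T1 A X hw; apply (hall T0 T1 A X hw). }
  split; [rewrite IF; lra | intros _].
  (* The test wave has constant amplitude [a]; a vanishing integral of g^+ would give it speed 0. *)
  destruct (hall m_infty p_infty _ _ (constant_wave F G m_infty p_infty a cF cG I ha hFa))
    as [_ [c [hc hX]]].
  rewrite IG; intros h0; apply hc.
  rewrite <- (is_derive_unique _ _ _ (hX 0 (conj I I))).
  apply is_derive_unique; replace (G a (- a) - G a a) with 0 by lra.
  auto_derive; [easy | field; exact ha].
- intros hC T0 T1 A X hw.
  apply dynamical_peaked_wave_ode in hw; [| easy | easy]; destruct hw as [hT hw].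
  destruct (constant_of_zero_derive T0 T1 A hT) as [a ha].
  (* The condition on f^+, applied at the current amplitude [A t], turns the amplitude equation into
     [A' = 0]. *)
  { intros t ht; destruct (hw t ht) as [_ [hA' _]].
    pose proof (proj1 (hC (A t))) as h0; rewrite IF in h0.
    now replace 0 with (/ 2 * (F (A t) (- A t) - F (A t) (A t))) by lra. }
  split; [now exists a |].
  exists (- (/ 2) * (G a (- a) - G a a) / a).
  assert (ha0 : a <> 0).
  { destruct (in_interval_nonempty T0 T1 hT) as [t ht].
    rewrite <- (ha t ht); now apply hw. }
  pose proof (proj2 (hC a) ha0) as hGa; rewrite IG in hGa.
  split.
  + apply Rmult_integral_contrapositive; split; [lra | now apply Rinv_neq_0_compat].
  + intros t ht; rewrite <- (ha t ht); now apply hw.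
- intros hex a; destruct (Req_dec a 0) as [-> | ha]; [now split |].
  destruct (hex a ha) as [A [X [hw [hA [c [hc hX]]]]]].
  apply dynamical_peaked_wave_ode in hw; [| easy | easy].
  (* A single instant suffices: at time 0 the derivatives 0 and [c] are compared with the right-hand
     sides of the system at amplitude [a]. *)
  assert (h0 : in_interval m_infty p_infty 0) by (now split).
  destruct (proj2 hw 0 h0) as [_ [hA' hX']].
  apply is_derive_unique in hA', hX'; rewrite (hA 0 h0) in hA', hX'.
  rewrite (is_derive_unique _ _ _ (constant_amplitude_derive _ _ _ _ _ hA h0)) in hA'.
  rewrite (is_derive_unique _ _ _ (hX 0 h0)) in hX'.
  rewrite IF, IG; split; [lra | intros _ hGa; apply hc; rewrite hX'].
  replace (G a (- a) - G a a) with 0 by lra; field; exact ha.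
- intros hC a ha.
  pose proof (proj1 (hC a)) as hFa; rewrite IF in hFa.
  pose proof (proj2 (hC a) ha) as hGa; rewrite IG in hGa.
  exists (fun _ => a), (fun t => - (/ 2) * (G a (- a) - G a a) / a * t).
  split; [apply constant_wave; try easy; lra |].
  split; [now intros t _ |].
  exists (- (/ 2) * (G a (- a) - G a a) / a); split.
  + apply Rmult_integral_contrapositive; split; [lra | now apply Rinv_neq_0_compat].
  + intros t _; auto_derive; [easy | ring].
Qed.
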